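(* Let $q$ be a prime power with $q\equiv 3\pmod 4$, and let $\tau\colon v\mapsto v^q$ be the field automorphism of $\mathbb{F}_{q^2}$ of order $2$. Let $G=\mathrm{Sym}(\mathbb{F}_{q^2})$, let $K=\mathrm{AGL}_1(q^2){:}\langle\tau\rangle\le \mathrm{A\Gamma L}_1(q^2)<G$, and let $g\in G$ be the permutation with $0^g=0$ and $v^g=v^{-1}$ for all $v\in\mathbb{F}_{q^2}^\times$. Let $\Gamma=\mathrm{Cos}(G,K,g)$ be the coset graph. Then $\Gamma$ is a connected $(\mathrm{A}_{q^2},2)$-arc-transitive Cayley graph on $\mathrm{A}_{q^2-2}$ with valency $q^2$.
   Context: For a group $G$, a core-free subgroup $K$ of $G$ (one containing no nontrivial normal subgroup of $G$) and $g\in G\setminus K$, the coset graph $\mathrm{Cos}(G,K,g)$ has as vertex set the set $[G:K]$ of right cosets of $K$ in $G$, with $Kx$ adjacent to $Ky$ ($x,y\in G$) if and only if $yx^{-1}\in KgK$; $G$ acts on it by right multiplication. $\mathrm{AGL}_1(q^2)$ is the group of permutations $v\mapsto av+b$ of $\mathbb{F}_{q^2}$ with $a\in\mathbb{F}_{q^2}^\times$, $b\in\mathbb{F}_{q^2}$, and $\mathrm{A\Gamma L}_1(q^2)$ is the group generated by $\mathrm{AGL}_1(q^2)$ and the field automorphisms of $\mathbb{F}_{q^2}$. Here $\mathrm{A}_{q^2}$ is $\mathrm{Alt}(\mathbb{F}_{q^2})\le G$ acting on $[G:K]$ by right multiplication. A $2$-arc is a triple of vertices $(v_0,v_1,v_2)$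 with $v_0,v_1$ adjacent, $v_1,v_2$ adjacent and $v_0\ne v_2$. For a group $X$ of automorphisms of $\Gamma$, $\Gamma$ is $(X,2)$-arc-transitive if $X$ is transitive on the set of $2$-arcs of $\Gamma$. For a group $H$ and an inverse-closed nonempty subset $S\subseteq H\setminus\{1\}$, the Cayley graph on $H$ with connection set $S$ has vertex set $H$, with $x,y$ adjacent if and only if $yx^{-1}\in S$; being a Cayley graph on $H$ is understood up to graph isomorphism. *)

(* Defs.v *)
From HB Require Import structures.
From mathcomp Require Import all_boot all_order all_algebra.
From mathcomp Require Import all_fingroup all_solvable all_field.
From mathcomp Require Import zify.

Set Implicit Arguments.
Unset Strict Implicit.
Unset Printing Implicit Defensive.

Import GRing.Theory.
Local Open Scope ring_scope.

(* A finite graph is an adjacency relation e : rel V on a finType V of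
   vertices.  Symmetry and irreflexivity of e are not part of the type: they
   hold for every Cayley graph (cayley_sym, cayley_irr), hence for every graph
   satisfying is_cayley_graph_on. *)
Section Graphs.

Variable V : finType.
Implicit Types (e : rel V) (X : {group {perm V}}).

Definition graph_connected e : Prop := forall u v : V, connect e u v.

Definition graph_regular e (d : nat) : Prop :=
  forall u : V, #|[set v | e u v]| = d.

Definition graph_aut e : {set {perm V}} :=
  [set s : {perm V} | [forall u, forall v, e (s u) (s v) == e u v]].

Definition two_arcs e : {set 3.-tuple V} :=
  [set t : 3.-tuple V | [exists u, exists v, exists w,
    [&& t == [tuple u; v; w], e u v, e v w & u != w]]].

Definition two_arc_transitive e X : Prop :=
  X \subset graph_aut e /\ [transitive X, on two_arcs e | 'P * 3].

End Graphs.

Definition graph_iso (V W : finType) (e : rel V) (e' : rel W) : Prop :=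
  exists2 f : V -> W, bijective f & forall u v, e' (f u) (f v) = e u v.

Definition cayley (hT : finGroupType) (S : {set hT}) : rel hT :=
  fun x y => (y * x^-1)%g \in S.

Definition connection_set (hT : finGroupType) (S : {set hT}) : Prop :=
  [/\ S != set0, 1%g \notin S & forall x, x \in S -> (x^-1)%g \in S].

Definition is_cayley_graph_on (V : finType) (e : rel V) (hT : finGroupType) :
  Prop := exists2 S : {set hT}, connection_set S & graph_iso e (cayley S).

Lemma cayley_sym (hT : finGroupType) (S : {set hT}) :
  connection_set S -> symmetric (cayley S).
Proof.
move=> [_ _ SV] x y; apply/idP/idP => /SV; by rewrite invMg invgK.
Qed.

Lemma cayley_irr (hT : finGroupType) (S : {set hT}) :
  connection_set S -> irreflexive (cayley S).
Proof. by move=> [_ S1 _] x; rewrite /cayley mulgV; apply/negbTE. Qed.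

Section CosetGraph.

Variables (gT : finGroupType) (G K : {group gT}) (g : gT).

Definition coset_vertex : finType := {A : {set gT} | A \in rcosets K G}.

(* Independent of the representatives x and y: see coset_graphE. *)
Definition coset_graph : rel coset_vertex := fun A B =>
  [exists x in G, exists y in G,
    [&& val A == K :* x, val B == K :* y
      & (y * x^-1)%g \in (K :* g) * K]]%g.

(* The permutation group induced on [G : K] by X acting by right
   multiplication; meaningful for X \subset G (see coset_permE). *)
Definition coset_perms (X : {group gT}) : {group {perm coset_vertex}} :=
  (actperm ('Rs^?) @* X)%G.

Lemma coset_graphE x y (A B : coset_vertex) :
  x \in G -> y \in G -> K \subset G ->
  val A = (K :* x)%g -> val B = (K :* y)%g ->
  coset_graph A B = ((y * x^-1)%g \in ((K :* g) * K)%g).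
Proof.
move=> Gx Gy sKG dA dB; apply/idP/idP; last first.
  move=> h; apply/existsP; exists x; rewrite Gx; apply/existsP; exists y.
  by rewrite Gy dA dB !eqxx.
case/existsP=> x' /andP[Gx' /existsP[y' /andP[Gy' /and3P[]]]].
rewrite dA dB => /eqP/rcoset_eqP; rewrite mem_rcoset => Kx.
move=> /eqP/rcoset_eqP; rewrite mem_rcoset => Ky.
case/mulsgP=> h k /rcosetP[k1 Kk1 ->] Kk dyx.
have -> : (y * x^-1 =
    ((y * y'^-1 * k1) * g) * (k * (x * x'^-1)^-1))%g.
  have -> : (y * y'^-1 * k1 * g * (k * (x * x'^-1)^-1) =
      y * y'^-1 * (k1 * g * k) * (x * x'^-1)^-1)%g by rewrite !mulgA.
  by rewrite -dyx invMg invgK !mulgA !mulgKV.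
apply: mem_mulg; last by apply: groupM => //; rewrite groupV.
by rewrite mem_rcoset mulgK; apply: groupM.
Qed.

Lemma coset_permE x (A : coset_vertex) :
  x \in G -> val (actperm ('Rs^?) x A) = (val A :* x)%g.
Proof.
move=> Gx; rewrite actpermE /= val_subact ifT; first exact: rcosetE.
have /subsetP/(_ x Gx) := actsRs_rcosets K G; rewrite /subact_dom => Nx.
by set D := finset _; have -> : D = rcosets K G by apply/setP=> C; rewrite inE.
Qed.

End CosetGraph.

Section AffineGroup.

Variable F : finFieldType.

Definition agl1 : {set {perm F}} :=
  [set s : {perm F} |
    [exists a : F, exists b : F, (a != 0) && [forall v, s v == a * v + b]]].

Lemma agl1P (s : {perm F}) :
  reflect (exists a b : F, a != 0 /\ forall v, s v = a * v + b) (s \in agl1).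
Proof.
rewrite inE; apply: (iffP existsP).
  move=> [a /existsP[b /andP[a0 /forallP h]]].
  by exists a, b; split=> // v; apply/eqP.
move=> [a [b [a0 h]]]; exists a; apply/existsP; exists b; rewrite a0.
by apply/forallP=> v; rewrite h.
Qed.

Lemma agl1_group_set : group_set agl1.
Proof.
apply/group_setP; split.
  apply/agl1P; exists 1, 0; split; first exact: oner_neq0.
  by move=> v; rewrite perm1 mul1r addr0.
move=> s t /agl1P[a [b [a0 hs]]] /agl1P[c [d [c0 ht]]]; apply/agl1P.
exists (c * a), (c * b + d); split; first by rewrite mulf_neq0.
by move=> v; rewrite permM hs ht mulrDr mulrA addrA.
Qed.

Canonical agl1_group := Group agl1_group_set.

(* The group AGL_1 : <tau>; for tau : v |-> v ^+ q the product is indeed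
   semidirect (affine_ext_sdprod). *)
Definition affine_ext (tau : {perm F}) : {group {perm F}} :=
  (agl1 <*> <[tau]>)%G.

End AffineGroup.

Section WellPosed.

Variables (q : nat) (F : finFieldType).
Hypothesis q_pp : exists p k : nat, [/\ prime p, (0 < k)%N & q = (p ^ k)%N].
Hypothesis q_gt2 : (2 < q)%N.
Hypothesis cardF : #|F| = (q ^ 2)%N.

Lemma expqK (v : F) : (v ^+ q) ^+ q = v.
Proof. by rewrite -exprM -[(q * q)%N]cardF expf_card. Qed.

Lemma tau_exists : exists tau : {perm F}, forall v, tau v = v ^+ q.
Proof. have inj_q : injective (fun v : F => v ^+ q).
  by move=> u v /= /(congr1 (fun w => w ^+ q)); rewrite !expqK.
by exists (perm inj_q) => v; rewrite permE. Qed.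

Lemma inversion_exists : exists g : {perm F},
  g 0 = 0 /\ forall v, v != 0 -> g v = v^-1.
Proof.
by exists (perm (@invr_inj F)); split=> [|v _]; rewrite permE ?invr0.
Qed.

Variable tau : {perm F}.
Hypothesis tauE : forall v, tau v = v ^+ q.

Lemma expqD (u v : F) : (u + v) ^+ q = u ^+ q + v ^+ q.
Proof.
have [p [k [p_pr k_gt0 dq]]] := q_pp.
have chF : p \in [pchar F].
  by apply: (@card_finPcharP _ p (k * 2)) => //; rewrite cardF dq expnM.
by apply: exprDn_pchar; rewrite (eq_pnat _ (pcharf_eq chF)) dq pnatX pnat_id.
Qed.

Lemma tau_cycle s : s \in <[tau]>%g -> s = 1%g \/ s = tau.
Proof.
have tau2 : (tau * tau = 1)%g.
  by apply/permP=> v; rewrite permM perm1 !tauE expqK.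
case/cycleP=> i ->; elim: i => [|i]; first by left.
by rewrite expgSr => -[] ->; [right; rewrite mul1g | left].
Qed.

Lemma affine_ext_sdprod : (agl1 F ><| <[tau]> = affine_ext tau)%g.
Proof.
apply: sdprodEY.
  rewrite cycle_subG inE; apply/subsetP=> _ /imsetP[s /agl1P[a [b [a0 hs]]] ->].
  apply/agl1P; exists (a ^+ q), (b ^+ q); split; first by rewrite expf_neq0.
  move=> v; have {1}-> : v = tau (v ^+ q) by rewrite tauE expqK.
  by rewrite permJ hs tauE expqD exprMn expqK.
apply/trivgP/subsetP=> s /setIP[/agl1P[a [b [a0 hs]]]].
case/tau_cycle=> ds; rewrite ds ?inE //.
have {}hs v : v ^+ q = a * v + b by rewrite -tauE -ds.
have b0 : b = 0.
  by have := hs 0; rewrite expr0n mulr0 add0r; case: q q_gt2 => //= n _ <-.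
have a1 : a = 1 by have := hs 1; rewrite expr1n b0 mulr1 addr0.
by apply/eqP/permP=> v; rewrite perm1 tauE hs a1 b0 mul1r addr0.
Qed.

Lemma affine_extP s : s \in affine_ext tau ->
  exists a b (e : nat), [/\ a != 0, (0 < e <= q)%N
    & forall v, s v = a * v ^+ e + b].
Proof.
move=> Ks; have: s \in (agl1 F * <[tau]>)%g by rewrite (sdprodW affine_ext_sdprod).
case/mulsgP=> h t /agl1P[a [b [a0 hh]]] /tau_cycle[] -> ->.
  exists a, b, 1%N; split; rewrite ?(ltnW (ltnW q_gt2)) //.
  by move=> v; rewrite mulg1 hh expr1.
exists (a ^+ q), (b ^+ q), q; split; rewrite ?expf_neq0 //.
  by rewrite leqnn (ltnW (ltnW q_gt2)).
by move=> v; rewrite permM hh tauE expqD exprMn.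
Qed.

Lemma card_roots (A : {set F}) (P : {poly F}) :
  P != 0 -> (forall v, v \in A -> root P v) -> (#|A| < size P)%N.
Proof.
move=> P0 rP; rewrite cardE; apply: max_poly_roots; rewrite ?enum_uniq //.
by apply/allP=> v; rewrite mem_enum => /rP.
Qed.

Lemma inversion_notin (g : {perm F}) :
  g 0 = 0 -> (forall v, v != 0 -> g v = v^-1) -> g \notin affine_ext tau.
Proof.
move=> g0 gE; apply/negP=> /affine_extP[a [b [e [a0 /andP[e0 leq] gK]]]].
have b0 : b = 0.
  by have := gK 0; rewrite g0 expr0n (gtn_eqF e0) mulr0 add0r.
have a1 : a = 1.
  have := gK 1.
  by rewrite gE ?oner_neq0 // invr1 expr1n b0 mulr1 addr0.
have szP := size_XnsubC (1 : F) (ltn0Sn e).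
have := @card_roots [set~ 0] ('X^(e.+1) - 1%:P).
rewrite -size_poly_eq0 szP cardsC1 cardF => /(_ isT) lt_q.
have {}lt_q : ((q ^ 2).-1 < e.+2)%N.
  apply: lt_q => v; rewrite !inE => v0; apply/rootP.
  have := gK v; rewrite gE // a1 b0 mul1r addr0 => vE.
  by rewrite !hornerE exprSr -vE mulVf // subrr.
move: q_gt2 leq lt_q; nia.
Qed.

Lemma affine_ext_corefree : gcore (affine_ext tau) ('Sym_F)%g = 1%g.
Proof.
apply/trivgP/subsetP=> n Nn; rewrite inE; apply/eqP/permP=> x; rewrite perm1.
apply/eqP/negPn/negP=> nx.
have sNK := gcore_sub (affine_ext tau) 'Sym_F.
have nN : (n ^ _ \in gcore (affine_ext tau) ('Sym_F)%g)%g.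
  by move=> t; rewrite memJ_norm // (subsetP (gcore_norm _ _)) ?inE.
have [z] : exists z, z \notin [set x; n x].
  apply/existsP; rewrite -negb_forall; apply/negP=> /forallP all_in.
  have: (#|F| <= #|[set x; n x]|)%N.
    by apply/subset_leq_card/subsetP=> v _; apply: all_in.
  by rewrite cardF cards2; move: q_gt2; case: (_ != _) => /=; nia.
rewrite !inE negb_or => /andP[zx znx].
pose c := ([~ n, tperm x z])%g.
have cK : c \in affine_ext tau.
  by apply: (subsetP sNK); rewrite /c commgEl groupM ?groupV.
have cE : c = (tperm (n x) (n z) * tperm x z)%g.
  by rewrite /c commgEr -tpermJ tpermV.
have c_moves : c (n x) != n x.
  rewrite cE permM tpermL; apply/negP=> /eqP h.
  have : n z = n x.
    apply: (@perm_inj _ (tperm x z)).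
    by rewrite h tpermD // eq_sym.
  by move/perm_inj/eqP; rewrite (negbTE zx).
have [a [b [e [a0 /andP[e0 leq] cP]]]] := affine_extP cK.
pose P : {poly F} := a *: 'X^e + b%:P - 'X.
have PE v : P.[v] = c v - v by rewrite /P !hornerE cP.
have P0 : P != 0.
  by apply/eqP=> P0; move: (PE (n x)); rewrite P0 horner0 => /esym/eqP;
    rewrite subr_eq0 (negbTE c_moves).
pose B := [set x; z; n x; n z].
have szP : (size P <= q.+1)%N.
  rewrite /P -addrA (leq_trans (size_polyD _ _)) // geq_max.
  rewrite (leq_trans (size_scale_leq _ _)) ?size_polyXn ?ltnS //=.
  rewrite (leq_trans (size_polyD _ _)) // geq_max size_polyN size_polyX.
  by rewrite (leq_trans (size_polyC_leq1 _)) //= ltnS ltnW // ltnW.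
have rootsP : (#|~: B| < size P)%N.
  apply: card_roots => // v; rewrite !inE !negb_or -!andbA => /and4P[vx vz vnx vnz].
  by apply/rootP; rewrite PE cE permM !tpermD 1?eq_sym // subrr.
have cardB : (#|B| <= 4)%N.
  apply: leq_trans (card_size [:: x; z; n x; n z]).
  by apply/subset_leq_card/subsetP=> v; rewrite !inE -!orbA.
have := cardsC B; rewrite cardF; move: q_gt2 szP rootsP cardB.
by move: (size P) (#|~: B|) (#|B|) => *; nia.
Qed.

End WellPosed.

(* Main.v *)
Require Import Defs.
From mathcomp Require Import all_boot all_order all_algebra.
From mathcomp Require Import all_fingroup all_solvable all_field.
From mathcomp Require Import zify ring.
Set Implicit Arguments.
Unset Strict Implicit.
Unset Printing Implicit Defensive.
Import GRing.Theory.
Local Open Scope ring_scope.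

(** Write n = q ^ 2, let K be the given affine group on F and t_c the
    translation by c.  All four properties are read off from a few facts about
    how K and the inversion g sit in Sym(F).

    Connectedness says that K and g generate Sym(F).  This is a theorem of
    Carlitz: affine maps and inversion already generate, because the
    transposition (0 a) is an explicit composition of them
    (agl1_inversion_generate).

    For the valency, note that g normalises the stabiliser of 0 in K, which
    consists of the maps v |-> a v and v |-> (a v) ^ q.  As K is this stabiliser
    times the translations, K g K is the union of the cosets K g t_c.  They are
    distinct: otherwise some g t_e g^-1 with e <> 0 lies in K, and then so does
    every g t_c g^-1, because all nontrivial translations are conjugate under
    homotheties and g maps homotheties to homotheties.  Hence g normalises K;
    since K and g generate Sym(F), K would be normal, whereas it is core-free
    (translation_conj_notin).  So the q ^ 2 neighbours of a vertex correspond
    to the points of F, and K permutes the neighbours of the base vertex as it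
    permutes F (translation_stab).

    The condition on q enters through parity.  The Frobenius map tau fixes q
    points and swaps the others in q (q - 1) / 2 pairs, an odd number, so tau
    is an odd permutation (frobenius_odd).  It fixes 0 and 1, so an element of
    K can be prescribed on an ordered pair of points together with its parity
    (affine_ext_2transitive_parity).  Therefore Alt(F) is transitive on the
    vertices, and K :&: Alt(F) is 2-transitive on the neighbours of the base
    vertex: this is 2-arc-transitivity.

    Finally let H be the group of even permutations fixing 0 and 1, a copy of
    the alternating group of degree n - 2.  By prescribing images and parity
    again, K H = Sym(F).  An element of K fixing 0 and 1 is 1 or tau, so
    K meets H trivially because tau is odd.  Thus H is regular on the vertices
    and the graph is a Cayley graph on H. *)

(** * Coset graphs of a whole group *)

Section CosetGraphOfFullGroup.

Local Open Scope group_scope.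

Variables (gT : finGroupType) (G K : {group gT}) (g : gT).
Hypothesis fullG : forall x, x \in G.

Local Notation Gamma := (coset_graph (G := G) (K := K) g).
Local Notation KgK := (K :* g * K).

Lemma rcoset_in_rcosets x : K :* x \in rcosets K G.
Proof. by apply/rcosetsP; exists x. Qed.

(** Every element of gT names a vertex, which removes the membership side
    conditions that representatives in a proper subgroup G would carry. *)
Definition coset_at x : coset_vertex G K := Sub (K :* x) (rcoset_in_rcosets x).

Lemma coset_atP (A : coset_vertex G K) : exists x, A = coset_at x.
Proof.
have /rcosetsP[x _ dA] := valP A; exists x.
by apply: val_inj.
Qed.

Lemma coset_at_eq x y : (coset_at x == coset_at y) = (x * y^-1 \in K).
Proof.
by rewrite -val_eqE /= -mem_rcoset; apply/eqP/idP => [/rcoset_eqP|/rcoset_eqP].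
Qed.

Lemma coset_at_mull k x : k \in K -> coset_at (k * x) = coset_at x.
Proof. by move=> Kk; apply/eqP; rewrite coset_at_eq mulgK. Qed.

Lemma coset_graph_at x y :
  Gamma (coset_at x) (coset_at y) = (y * x^-1 \in KgK).
Proof. by apply: coset_graphE => //; apply/subsetP. Qed.

Lemma mem_dcoset_mul k h x :
  k \in K -> h \in K -> (k * x * h \in KgK) = (x \in KgK).
Proof.
move=> Kk Kh.
have imp k' h' y : k' \in K -> h' \in K -> y \in KgK -> k' * y * h' \in KgK.
  move=> Kk' Kh' /mulsgP[_ h2 /rcosetP[k2 Kk2 ->] Kh2 ->].
  by rewrite !mulgA -(mulgA _ h2) mem_mulg ?groupM // mem_rcoset mulgK groupM.
apply/idP/idP; last exact: imp.
move=> /(imp k^-1 h^-1); rewrite !groupV => /(_ Kk Kh).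
by rewrite !mulgA mulVg mul1g mulgK.
Qed.

Lemma dcoset_refl : g \in KgK.
Proof. by rewrite -[X in X \in _]mulg1 mem_mulg ?rcoset_refl. Qed.

Lemma dcosetV x : g^-1 = g -> x \in KgK -> x^-1 \in KgK.
Proof.
move=> gV /mulsgP[_ h /rcosetP[k Kk ->] Kh ->].
by rewrite !invMg gV mulgA mem_dcoset_mul ?groupV ?dcoset_refl.
Qed.

(** If K x and K w x, as well as K w x and K z w x, are joined by a path for
    all x, then so are K x and K z w x.  Hence the z for which K x and K z x are
    always in the same component form a group, and it contains K and g. *)
Lemma coset_graph_connected :
  (forall D : {group gT}, K \subset D -> g \in D -> forall x, x \in D) ->
  graph_connected Gamma.
Proof.
move=> gen.
pose D := [set z | [forall x, connect Gamma (coset_at x) (coset_at (z * x))]].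
have DP z : reflect (forall x, connect Gamma (coset_at x) (coset_at (z * x)))
                    (z \in D) by rewrite inE; apply: forallP.
have gD : group_set D.
  apply/group_setP; split; first by apply/DP => x; rewrite mul1g connect0.
  move=> z w /DP Dz /DP Dw; apply/DP => x; rewrite -mulgA.
  exact: connect_trans (Dw x) (Dz _).
have all_in := gen (Group gD).
move=> A B; have [x ->] := coset_atP A; have [y ->] := coset_atP B.
rewrite -[y](mulgKV x); apply/DP/all_in.
  by apply/subsetP => k Kk; apply/DP => z; rewrite coset_at_mull.
by apply/DP => z; rewrite connect1 // coset_graph_at mulgK dcoset_refl.
Qed.

(** The image of phi is a complement of K, so h |-> K phi(h) identifies hT with
    the vertices; under this identification the adjacency of two vertices
    depends on their quotient only. *)
Lemma coset_graph_cayley (hT : finGroupType) (phi : hT -> gT) :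
    g^-1 = g -> g \notin K -> {morph phi : x y / x * y} ->
    (forall h, phi h \in K -> h = 1) ->
    (forall x, exists h, phi h * x^-1 \in K) ->
  is_cayley_graph_on Gamma hT.
Proof.
move=> gV Kg phiM phi_tr phi_all.
have phi1 : phi 1 = 1 by apply: (mulgI (phi 1)); rewrite -phiM !mulg1.
have phiV h : phi h^-1 = (phi h)^-1.
  by apply: (mulgI (phi h)); rewrite -phiM !mulgV.
exists [set h | phi h \in KgK].
  split=> [||h]; last by rewrite !inE phiV; apply: dcosetV.
    have [h] := phi_all g; rewrite -mem_rcoset => Kgh.
    apply/set0Pn; exists h; rewrite inE -[phi h]mulg1.
    by rewrite mem_mulg.
  rewrite inE phi1; apply: contra Kg.
  case/mulsgP=> _ h /rcosetP[k Kk ->] Kh d1.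
  by rewrite -(groupMl _ Kk) -(groupMr _ Kh) -d1 group1.
pose f h := coset_at (phi h).
have f_inj : injective f.
  move=> h h' /eqP; rewrite coset_at_eq -phiV -phiM => /phi_tr/eqP.
  by rewrite -eq_mulgV1 => /eqP.
have f_surj A : exists h, f h == A.
  have [x ->] := coset_atP A; have [h Kh] := phi_all x.
  by exists h; rewrite coset_at_eq.
pose f' A := xchoose (f_surj A).
have f'K : cancel f' f by move=> A; apply/eqP/(xchooseP (f_surj A)).
exists f'; first by exists f => // h; apply: f_inj; rewrite f'K.
move=> A B; rewrite -{2}(f'K A) -{2}(f'K B) coset_graph_at.
by rewrite /cayley inE phiM phiV.
Qed.

Section TwoArcs.

Variable X : {group gT}.

Local Notation Xperms := (coset_perms G K X).

Lemma actperm_coset_at z x :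
  actperm ('Rs^? : action _ (coset_vertex G K)) z (coset_at x) =
  coset_at (x * z).
Proof. by apply: val_inj; rewrite coset_permE //= -rcosetM. Qed.

Lemma coset_permsP (s : {perm coset_vertex G K}) :
  reflect (exists2 z, z \in X & s = actperm 'Rs^? z) (s \in Xperms).
Proof.
have dom z : z \in subact_dom (mem (rcosets K G)) 'Rs.
  have /subsetP/(_ z (fullG z)) := actsRs_rcosets K G.
  rewrite /subact_dom; set D := finset _.
  by have -> : D = rcosets K G by apply/setP=> C; rewrite inE.
apply: (iffP morphimP) => [[z _ Xz ->]|[z Xz ->]]; exists z => //; exact: dom.
Qed.

Lemma mem_coset_perms z : z \in X -> actperm 'Rs^? z \in Xperms.
Proof. by move=> Xz; apply/coset_permsP; exists z. Qed.

Lemma n_act_coset_at x y z w :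
  ('P * 3)%act [tuple coset_at x; coset_at y; coset_at z] (actperm 'Rs^? w) =
  [tuple coset_at (x * w); coset_at (y * w); coset_at (z * w)].
Proof. by apply: val_inj; rewrite /= !apermE !actperm_coset_at. Qed.

Lemma coset_perms_aut : Xperms \subset graph_aut Gamma.
Proof.
apply/subsetP => _ /coset_permsP[z _ ->]; rewrite inE.
apply/forallP => A; apply/forallP => B.
have [x ->] := coset_atP A; have [y ->] := coset_atP B.
by rewrite !actperm_coset_at !coset_graph_at invMg mulgA mulgK.
Qed.

(** Transitivity on the vertices moves the middle vertex of a 2-arc to K, and
    2-transitivity of the elements of X in K on the cosets contained in K g K
    then moves the two end vertices to K a and K b. *)
Lemma coset_graph_two_arc_transitive a b :
    g^-1 = g -> a \in KgK -> b \in KgK -> a * b^-1 \notin K ->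
    (forall x, exists2 k, k \in K & k * x \in X) ->
    (forall y z, y \in KgK -> z \in KgK -> y * z^-1 \notin K ->
      exists2 k, k \in K :&: X & a * k * y^-1 \in K /\ b * k * z^-1 \in K) ->
  two_arc_transitive Gamma Xperms.
Proof.
move=> gV Da Db ab Xtr X2tr; split; first exact: coset_perms_aut.
(* The base 2-arc, to which all others are moved. *)
pose t0 := [tuple coset_at a; coset_at 1; coset_at b].
have arcP (t : 3.-tuple (coset_vertex G K)) :
    reflect (exists x y z,
      [/\ t = [tuple coset_at (y * x); coset_at x; coset_at (z * x)],
          y \in KgK, z \in KgK & y * z^-1 \notin K]) (t \in two_arcs Gamma).
  apply: (iffP idP) => [|[x [y [z [-> Dy Dz yz]]]]]; last first.
    rewrite inE; apply/existsP; exists (coset_at (y * x)).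
    apply/existsP; exists (coset_at x).
    apply/existsP; exists (coset_at (z * x)).
    rewrite eqxx !coset_graph_at coset_at_eq !invMg !mulgA mulgK mulgV mul1g.
    by rewrite mulgK dcosetV // Dz yz.
  rewrite inE => /existsP[A /existsP[B /existsP[C /and4P[/eqP-> AB BC AC]]]].
  have [y dA] := coset_atP A; have [x dB] := coset_atP B.
  have [z dC] := coset_atP C; exists x, (y * x^-1), (z * x^-1).
  move: AB BC AC; rewrite dA dB dC !mulgKV !coset_graph_at coset_at_eq.
  move=> AB BC AC.
  split=> //; last by rewrite invMg invgK mulgA mulgKV.
  by rewrite -[y * _]invgK invMg invgK dcosetV.
apply/imsetP; exists t0.
  by apply/arcP; exists 1, a, b; rewrite !mulg1.
apply/setP => t; apply/arcP/orbitP; last first.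
  case=> _ /coset_permsP[z Xz ->] <-.
  by exists z, a, b; split=> //; rewrite n_act_coset_at mul1g.
case=> x [y [z [-> Dy Dz yz]]].
have [k Kk Xkx] := Xtr x.
have Dk u : u \in KgK -> u * k^-1 \in KgK.
  by move=> Du; rewrite -[u]mul1g mem_dcoset_mul ?groupV.
(* With k * x in place of x as representative of the middle vertex, the ends
   y * x and z * x become y * k^-1 and z * k^-1 times that representative. *)
have [|h /setIP[Kh Xh] [ah bh]] := X2tr _ _ (Dk _ Dy) (Dk _ Dz).
  by rewrite invMg invgK mulgA mulgKV.
exists (actperm 'Rs^? (h * (k * x))).
  by apply: mem_coset_perms; rewrite groupM.
rewrite n_act_coset_at /t0.
congr [tuple _; _; _]; apply/eqP; rewrite coset_at_eq.
- by move: ah; rewrite !invMg invgK !mulgA mulgK.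
- by rewrite mul1g !mulgA mulgK groupM.
- by move: bh; rewrite !invMg invgK !mulgA mulgK.
Qed.

End TwoArcs.

Lemma coset_graph_regular (I : finType) (n : I -> gT) :
    (forall i, n i \in KgK) ->
    (forall y, y \in KgK -> exists i, n i * y^-1 \in K) ->
    (forall i j, n i * (n j)^-1 \in K -> i = j) ->
  graph_regular Gamma #|I|.
Proof.
move=> Dn n_all n_inj A; have [x ->] := coset_atP A.
have f_inj : injective (fun i => coset_at (n i * x)).
  by move=> i j /eqP; rewrite coset_at_eq invMg mulgA mulgK => /n_inj.
rewrite -(card_imset predT f_inj); apply: eq_card => B; rewrite inE.
apply/idP/imsetP => [|[i _ ->]]; last by rewrite coset_graph_at mulgK Dn.
have [y ->] := coset_atP B; rewrite coset_graph_at => /n_all[i Ki].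
exists i => //; apply/esym/eqP.
by rewrite coset_at_eq -(mulgKV x y) invMg mulgA mulgK.
Qed.

End CosetGraphOfFullGroup.

(** * Parity of permutations *)

Section ExtendPerm.

Local Open Scope group_scope.

Variables (T U : finType) (f : T -> U).
Hypothesis f_inj : injective f.

(** Transport of permutations along an injection realises the alternating
    group of the smaller type inside that of the larger one. *)
Definition extend_fun (s : {perm T}) (y : U) : U :=
  if [pick x | f x == y] is Some x then f (s x) else y.

Lemma extend_fun_in s x : extend_fun s (f x) = f (s x).
Proof.
by rewrite /extend_fun; case: pickP => [z /eqP/f_inj-> // | /(_ x)/eqP].
Qed.

Lemma extend_fun_out s y : y \notin codom f -> extend_fun s y = y.
Proof.
rewrite /extend_fun; case: pickP => // x /eqP <-.
by rewrite codom_f.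
Qed.

Lemma extend_funK s : cancel (extend_fun s) (extend_fun s^-1).
Proof.
move=> y; have [/codomP[x ->]|fy] := boolP (y \in codom f).
  by rewrite !extend_fun_in permK.
by rewrite !extend_fun_out.
Qed.

Definition extend_perm s : {perm U} := perm (can_inj (extend_funK s)).

Lemma extend_perm_in s x : extend_perm s (f x) = f (s x).
Proof. by rewrite permE extend_fun_in. Qed.

Lemma extend_perm_out s y : y \notin codom f -> extend_perm s y = y.
Proof. by rewrite permE; apply: extend_fun_out. Qed.

Lemma extend_permM : {morph extend_perm : s t / s * t}.
Proof.
move=> s t; apply/permP => y; rewrite permM.
have [/codomP[x ->]|fy] := boolP (y \in codom f).
  by rewrite !extend_perm_in permM.
by rewrite !extend_perm_out.
Qed.

Lemma extend_perm1 : extend_perm 1 = 1.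
Proof. by apply: (mulgI (extend_perm 1)); rewrite -extend_permM !mulg1. Qed.

Lemma extend_perm_inj : injective extend_perm.
Proof.
move=> s t st; apply/permP => x; apply: f_inj.
by rewrite -!extend_perm_in st.
Qed.

Lemma extend_tperm x y : extend_perm (tperm x y) = tperm (f x) (f y).
Proof.
apply/permP => z; have [/codomP[w ->]|fz] := boolP (z \in codom f).
  by rewrite extend_perm_in (inj_tperm _ _ _ f_inj).
by rewrite extend_perm_out // tpermD //; apply: contraNneq fz => <-;
  exact: codom_f.
Qed.

(** Extension turns a product of transpositions into a product of equally many
    transpositions. *)
Lemma odd_extend_perm s : odd_perm (extend_perm s) = odd_perm s.
Proof.
have [ts -> _] := prod_tpermP s; elim: ts => [|[x y] ts IH].
  by rewrite big_nil extend_perm1 !odd_perm1.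
rewrite big_cons extend_permM !odd_permM IH extend_tperm !odd_tperm.
by rewrite (inj_eq f_inj).
Qed.

Lemma extend_perm_onto (t : {perm U}) :
  (forall y, y \notin codom f -> t y = y) -> exists s, extend_perm s = t.
Proof.
move=> t_fix.
have t_codom x : exists x', f x' == t (f x).
  suff /codomP[x' ->] : t (f x) \in codom f by exists x'.
  apply/negPn/negP => out; have := t_fix _ out.
  by move=> /perm_inj dx; move: out; rewrite dx codom_f.
pose s x := xchoose (t_codom x).
have sE x : f (s x) = t (f x) by apply/eqP/(xchooseP (t_codom x)).
have s_inj : injective s.
  by move=> x y /(congr1 f); rewrite !sE => /perm_inj/f_inj.
exists (perm s_inj); apply/permP => y.
have [/codomP[x ->]|fy] := boolP (y \in codom f).
  by rewrite extend_perm_in permE sE.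
by rewrite extend_perm_out // t_fix.
Qed.

End ExtendPerm.

(** Multiplying an involution by the transposition of x and s x splits off one
    2-cycle: the product fixes x and s x and agrees with s elsewhere. *)
Lemma odd_perm_involution (T : finType) (s : {perm T}) (m : nat) :
    (forall x, s (s x) = x) -> #|[set x | s x != x]| = m.*2 ->
  odd_perm s = odd m.
Proof.
elim: m s => [|m IH] s s_inv cards.
  suff -> : s = 1%g by rewrite odd_perm1.
  apply/permP => x; rewrite perm1; apply/eqP/negPn/negP => sx.
  by move/cards0_eq/setP/(_ x): cards; rewrite !inE sx.
have /card_gt0P[x] : (0 < #|[set x | s x != x]|)%N by rewrite cards.
rewrite inE => sx; pose s' := (tperm x (s x) * s)%g.
have s'x : s' x = x by rewrite permM tpermL.
have s'sx : s' (s x) = s x by rewrite permM tpermR.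
have s'E y : y != x -> y != s x -> s' y = s y.
  by move=> yx ysx; rewrite permM tpermD // eq_sym.
rewrite -[s](mulKg (tperm x (s x))) tpermV odd_mul_tperm eq_sym sx IH //.
  move=> y; have [->|yx] := eqVneq y x; first by rewrite !s'x.
  have [->|ysx] := eqVneq y (s x); first by rewrite !s'sx.
  rewrite (s'E y) // s'E ?s_inv ?(inj_eq perm_inj) //.
  by apply: contraNneq ysx => <-; rewrite s_inv.
have moved : [set y | s' y != y] = [set y | s y != y] :\ x :\ s x.
  apply/setP => y; rewrite !inE; have [->|yx] := eqVneq y x.
    by rewrite s'x eqxx andbF.
  have [->|ysx] := eqVneq y (s x); first by rewrite s'sx eqxx.
  by rewrite s'E.
have := cards; rewrite (cardsD1 x) (cardsD1 (s x)) -moved !inE sx s_inv.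
by rewrite eq_sym sx doubleS => -[].
Qed.

(** * Affine maps and inversion generate the symmetric group *)

Section Carlitz.

Variable F : finFieldType.

Definition translation (c : F) : {perm F} := perm (addIr c).

Lemma translationE c v : translation c v = v + c.
Proof. by rewrite permE. Qed.

Lemma translation_agl1 c : translation c \in agl1 F.
Proof.
apply/agl1P; exists 1, c; split=> [|v]; first exact: oner_neq0.
by rewrite translationE mul1r.
Qed.

Lemma translationB c d :
  (translation c * (translation d)^-1 = translation (c - d))%g.
Proof.
apply: (mulIg (translation d)); rewrite mulgKV.
by apply/permP => v; rewrite permM !translationE addrA subrK.
Qed.

Definition homothety (a : F) (a0 : a != 0) : {perm F} := perm (mulfI a0).

Lemma homothetyE a (a0 : a != 0) v : homothety a0 v = a * v.
Proof. by rewrite permE. Qed.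

Lemma homothety_agl1 a (a0 : a != 0) : homothety a0 \in agl1 F.
Proof.
apply/agl1P; exists a, 0; split=> // v.
by rewrite homothetyE addr0.
Qed.

Lemma tperm_generate (D : {group {perm F}}) :
  (forall x y : F, x != y -> tperm x y \in D) -> forall s, s \in D.
Proof.
move=> Dt s; have [ts -> ts_ne] := prod_tpermP s.
rewrite big_seq group_prod // => -[x y] /(allP ts_ne); exact: Dt.
Qed.

(** Carlitz: the map
    x |-> - a ^ 2 / (1 / (1 / (x - a) + 1 / a) - a), with 1 / 0 read as 0, is
    the identity as a rational function, but passing through infinity makes it
    exchange 0 and a.  The remaining transpositions are conjugates of these by
    translations. *)
Lemma agl1_inversion_generate (g : {perm F}) (D : {group {perm F}}) :
    g 0 = 0 -> (forall v, v != 0 -> g v = v^-1) ->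
    agl1 F \subset D -> g \in D ->
  forall s, s \in D.
Proof.
move=> g0 gE /subsetP sD Dg.
have {g0}gE v : g v = v^-1.
  by have [->|/gE //] := eqVneq v 0; rewrite g0 invr0.
have D0 a : a != 0 -> tperm 0 a \in D.
  move=> a0; have a20 : - a ^+ 2 != 0 by rewrite oppr_eq0 expf_neq0.
  have -> : tperm 0 a = (translation (- a) * g * translation (a^-1)%R * g *
             translation (- a) * g * homothety a20)%g.
    apply/permP => x; rewrite !permM homothetyE !translationE !gE.
    have [->|x0] := eqVneq x 0.
      rewrite tpermL add0r (invrN a) addNr invr0 add0r (invrN a) mulrNN.
      by rewrite expr2 -mulrA mulfV // mulr1.
    have [->|xa] := eqVneq x a.
      by rewrite tpermR subrr invr0 add0r invrK subrr invr0 mulr0.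
    rewrite tpermD 1?eq_sym //; have xa0 : x - a != 0 by rewrite subr_eq0.
    have dx : a + (x - a) = x by rewrite addrC subrK.
    have da : (x - a) * a + - a * x = - a ^+ 2 by ring.
    (* da is the numerator of the last inverted term over the common
       denominator, in the form in which field asks for it to be nonzero. *)
    by field; rewrite dx da a0 xa0 x0.
  by rewrite !groupM // sD ?translation_agl1 ?homothety_agl1.
apply: tperm_generate => x y xy.
have -> : tperm x y = (tperm 0 (y - x) ^ translation x)%g.
  by rewrite tpermJ !translationE add0r subrK.
by rewrite groupJ ?D0 ?sD ?translation_agl1 // subr_eq0 eq_sym.
Qed.

End Carlitz.

(** * The affine semilinear group *)

Section AffineExt.

Variables (q : nat) (F : finFieldType) (tau g : {perm F}).
Hypothesis q_pp : exists p k : nat, [/\ prime p, (0 < k)%N & q = (p ^ k)%N].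
Hypothesis q_mod4 : (q = 3 %[mod 4])%N.
Hypothesis cardF : #|F| = (q ^ 2)%N.
Hypothesis tauE : forall v, tau v = v ^+ q.
Hypothesis g0 : g 0 = 0.
Hypothesis gE : forall v, v != 0 -> g v = v^-1.

Local Notation K := (affine_ext tau).

Lemma q_gt2 : (2 < q)%N.
Proof. by move: q_mod4; case: q => [|[|[|]]]. Qed.

(** As q - 1 divides q ^ 2 - 1, the polynomial X ^ q - X divides
    X ^ (q ^ 2) - X, which is a product of distinct linear factors over F; so
    it has as many roots in F as its degree. *)
Lemma card_frobenius_fixed : #|[set v | tau v == v]| = q.
Proof.
have q_gt0 : (0 < q)%N by rewrite (ltn_trans _ q_gt2).
pose p : {poly F} := 'X^q - 'X.
have pX n : (0 < n)%N -> 'X^n - 'X = 'X * ('X^(n.-1) - 1) :> {poly F}.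
  by case: n => // n _; rewrite exprS mulrBr mulr1.
have : p %| \prod_x ('X - x%:P).
  rewrite -finField_genPoly cardF /p !pX ?expn_gt0 ?q_gt0 //.
  rewrite dvdp_mul2l ?polyX_eq0 //.
  have -> : ((q ^ 2).-1 = q.-1 * q.+1)%N.
    by move: q_gt0; case: q => // n _ /=; lia.
  by rewrite exprM [X in _ %| X]subrX1 dvdp_mulr.
case/dvdp_prod_XsubC => m pm.
set r := mask m _ in pm.
have szp : size p = q.+1.
  rewrite /p size_polyDl size_polyXn // size_polyN size_polyX ltnS.
  by rewrite ltnW // q_gt2.
have r_uniq : uniq r by rewrite mask_uniq // index_enum_uniq.
move: szp; rewrite (eqp_size pm) size_prod_XsubC => -[<-].
rewrite -(card_uniqP r_uniq); apply: eq_card => v.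
rewrite inE -(root_prod_XsubC r v) -(eqp_root pm) rootE /p !hornerE.
by rewrite subr_eq0 tauE.
Qed.

(** The Frobenius map is an involution moving q ^ 2 - q points, and
    q (q - 1) / 2 is odd as q is 3 modulo 4. *)
Lemma frobenius_odd : odd_perm tau.
Proof.
have moved : #|[set v | tau v != v]| = (q * q.-1)./2.*2.
  have -> : [set v | tau v != v] = ~: [set v | tau v == v].
    by apply/setP => v; rewrite !inE.
  rewrite cardsCs setCK cardF card_frobenius_fixed.
  rewrite even_halfK; first by case: q => // n /=; lia.
  by case: q => // n; rewrite oddM /=; case: odd.
rewrite (odd_perm_involution _ moved); last by move=> v; rewrite !tauE expqK.
have -> : q = (4 * (q %/ 4) + 3)%N.
  by rewrite {1}(divn_eq q 4) q_mod4 mulnC.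
set k := (q %/ 4)%N.
have -> : ((4 * k + 3) * (4 * k + 3).-1 =
           (4 * k * k + 5 * k + 1).*2.+1.*2)%N by nia.
by rewrite doubleK oddS odd_double.
Qed.

Lemma inversionE v : g v = v^-1.
Proof. by have [->|/gE //] := eqVneq v 0; rewrite g0 invr0. Qed.

Lemma inversionV : (g^-1 = g)%g.
Proof.
apply: (mulgI g); rewrite mulgV; apply/permP => v.
by rewrite permM !inversionE invrK perm1.
Qed.

Lemma frobenius_in : tau \in K.
Proof. by rewrite mem_gen // inE cycle_id orbT. Qed.

Lemma agl1_sub : agl1 F \subset K.
Proof. exact: joing_subl. Qed.

Lemma translation_in c : translation c \in K.
Proof. exact: subsetP agl1_sub _ (translation_agl1 c). Qed.

Lemma homothety_in a (a0 : a != 0) : homothety a0 \in K.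
Proof. exact: subsetP agl1_sub _ (homothety_agl1 a0). Qed.

Lemma affine_ext_fix0 k : k \in K -> k 0 = 0 ->
  exists a (a0 : a != 0), k = homothety a0 \/ k = (homothety a0 * tau)%g.
Proof.
rewrite -(sdprodW (affine_ext_sdprod q_pp q_gt2 cardF tauE)).
case/mulsgP => h t /agl1P[a [b [a0 hE]]] /(tau_cycle cardF tauE) dt dk k0.
have t0 : t 0 = 0.
  case: dt => ->; rewrite ?perm1 // tauE expr0n gtn_eqF //.
  by rewrite (ltn_trans _ q_gt2).
have b0 : b = 0.
  by apply: (@perm_inj _ t); rewrite t0 -[RHS]k0 dk permM hE mulr0 add0r.
exists a, a0; have -> : homothety a0 = h.
  by apply/permP => v; rewrite homothetyE hE b0 addr0.
by case: dt dk => -> ->; rewrite ?mulg1; [left|right].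
Qed.

Lemma affine_ext_fix01 k : k \in K -> k 0 = 0 -> k 1 = 1 -> k = 1%g \/ k = tau.
Proof.
move=> Kk k0 k1; have [a [a0 dk]] := affine_ext_fix0 Kk k0.
have a1 : a = 1.
  have t1 : tau 1 = 1 by rewrite tauE expr1n.
  case: dk => dk; move: k1; rewrite dk ?permM homothetyE mulr1 //.
  by rewrite -[RHS]t1 => /perm_inj.
have h1 : homothety a0 = 1%g.
  by apply/permP => v; rewrite homothetyE a1 mul1r perm1.
by rewrite h1 mul1g in dk.
Qed.

(** Inversion commutes with tau and conjugates v |-> a v to v |-> v / a. *)
Lemma inversion_normalises_stab k :
  k \in K -> k 0 = 0 -> (g * k * g^-1)%g \in K.
Proof.
move=> Kk k0; rewrite inversionV; have [a [a0 dk]] := affine_ext_fix0 Kk k0.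
have gh : (g * homothety a0 * g)%g \in K.
  have a'0 : a^-1 != 0 by rewrite invr_eq0.
  have -> : (g * homothety a0 * g)%g = homothety a'0.
    by apply/permP => v; rewrite !permM !homothetyE !inversionE invfM invrK.
  exact: homothety_in.
have gt : (g * tau * g)%g = tau.
  by apply/permP => v; rewrite !permM !inversionE !tauE exprVn invrK.
case: dk => -> //.
have -> : (g * (homothety a0 * tau) * g =
           (g * homothety a0 * g) * (g * tau * g))%g.
  have gg : (g * g = 1)%g by rewrite -{1}inversionV mulVg.
  by rewrite !mulgA -(mulgA _ g g) gg mulg1.
by rewrite gt groupM // frobenius_in.
Qed.

Lemma affine_ext_2transitive c d :
  c != d -> exists2 k, k \in K & k 0 = c /\ k 1 = d.
Proof.
move=> cd; have dc0 : d - c != 0 by rewrite subr_eq0 eq_sym.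
exists (homothety dc0 * translation c)%g.
  by rewrite groupM ?homothety_in ?translation_in.
by rewrite !permM !homothetyE !translationE mulr0 add0r mulr1 subrK.
Qed.

(** Precomposing with tau changes the parity but not the images of 0 and 1. *)
Lemma affine_ext_2transitive_parity c d (b : bool) : c != d ->
  exists2 k, k \in K & [/\ odd_perm k = b, k 0 = c & k 1 = d].
Proof.
move=> /affine_ext_2transitive[k Kk [k0 k1]].
have [kb | kb] := eqVneq (odd_perm k) b; first by exists k.
exists (tau * k)%g; first by rewrite groupM ?frobenius_in.
rewrite odd_permM frobenius_odd !permM !tauE expr1n expr0n.
rewrite gtn_eqF ?(ltn_trans _ q_gt2) //; split=> //.
by case: b (odd_perm k) kb => [] [].
Qed.

Lemma affine_ext_generates (D : {group {perm F}}) :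
  K \subset D -> g \in D -> forall s, s \in D.
Proof.
move=> sKD; apply: agl1_inversion_generate => //.
exact: subset_trans agl1_sub sKD.
Qed.

(** If g conjugates one nontrivial translation into K, it does so with all of
    them, since they are conjugate under homotheties and g normalises the
    stabiliser of 0.  Then g normalises K, and so does everything generated by
    K and g, contradicting core-freeness. *)
Lemma translation_conj_notin e :
  e != 0 -> (g * translation e * g^-1)%g \notin K.
Proof.
move=> e0; apply/negP => Kge.
have KgV k : k \in K -> (g * k * g^-1)%g \in K.
  have conjM x y : (g * (x * y) * g^-1 = (g * x * g^-1) * (g * y * g^-1))%g.
    by rewrite !mulgA mulgKV.
  have Kgt c : (g * translation c * g^-1)%g \in K.
    have [->|c0] := eqVneq c 0.
      by rewrite -(subrr (0 : F)) -translationB mulgV mulg1 mulgV group1.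
    have a0 : c / e != 0 by rewrite mulf_neq0 ?invr_eq0.
    have -> : translation c =
        ((homothety a0)^-1 * (translation e * homothety a0))%g.
      apply: (mulgI (homothety a0)); rewrite mulKVg; apply/permP => v.
      by rewrite !permM !homothetyE !translationE mulrDr divfK.
    rewrite 2!conjM (groupM _ (groupM Kge _)) //;
      apply: inversion_normalises_stab.
    - by rewrite groupV homothety_in.
    - by apply: (@perm_inj _ (homothety a0)); rewrite permKV homothetyE mulr0.
    - exact: homothety_in.
    - by rewrite homothetyE mulr0.
  move=> Kk.
  (* k followed by the translation taking k 0 back to 0 fixes 0. *)
  rewrite -[k](mulgKV (translation (k 0))) conjM groupM //.
  apply: inversion_normalises_stab.
    by rewrite groupM ?groupV ?translation_in.
  rewrite permM; apply: (@perm_inj _ (translation (k 0))).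
  by rewrite permKV translationE add0r.
have nKg : g \in 'N(K)%g.
  rewrite inE; apply/subsetP => _ /imsetP[k Kk ->].
  have -> : (k ^ g = g * k * g^-1)%g by rewrite conjgE !inversionV mulgA.
  exact: KgV.
have nK s : s \in 'N(K)%g := affine_ext_generates (normG K) nKg s.
have : K \subset gcore K ('Sym_F)%g.
  by apply: gcore_max => //; apply/subsetP => s _; exact: nK.
rewrite (affine_ext_corefree q_pp q_gt2 cardF tauE).
move=> /subsetP/(_ _ frobenius_in); rewrite inE => /eqP t1.
by move: frobenius_odd; rewrite t1 odd_perm1.
Qed.

(** * Neighbours in the coset graph *)

(** An element h of K is t_c preceded by an element fixing 0, where c = h 0,
    and g carries the latter back into K. *)
Lemma dcoset_translation y : y \in (K :* g * K)%g ->
  exists c, (g * translation c * y^-1)%g \in K.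
Proof.
case/mulsgP => _ h /rcosetP[k Kk ->] Kh ->; exists (h 0).
have -> : (g * translation (h 0) * (k * g * h)^-1 =
           (g * (translation (h 0) * h^-1) * g^-1) * k^-1)%g.
  by rewrite !invMg !mulgA.
rewrite groupM ?groupV //; apply: inversion_normalises_stab.
  by rewrite groupM ?groupV ?translation_in.
by rewrite permM translationE add0r permK.
Qed.

Lemma translation_dcoset c : (g * translation c)%g \in (K :* g * K)%g.
Proof. by rewrite mem_mulg ?rcoset_refl ?translation_in. Qed.

Lemma translation_dcoset_inj c d :
  (g * translation c * (g * translation d)^-1)%g \in K -> c = d.
Proof.
have -> : (g * translation c * (g * translation d)^-1 =
           g * translation (c - d) * g^-1)%g.
  by rewrite -translationB invMg !mulgA.
move=> Kcd; apply/eqP; rewrite -subr_eq0; apply: contraLR Kcd.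
exact: translation_conj_notin.
Qed.

(** K moves the vertices K g t_c as it moves the points c. *)
Lemma translation_stab c d k : k \in K -> k c = d ->
  (g * translation c * k * (g * translation d)^-1)%g \in K.
Proof.
move=> Kk kc.
have -> : (g * translation c * k * (g * translation d)^-1 =
           g * (translation c * k * (translation d)^-1) * g^-1)%g.
  by rewrite invMg !mulgA.
apply: inversion_normalises_stab.
  by rewrite !groupM ?groupV ?translation_in.
rewrite !permM translationE add0r kc; apply: (@perm_inj _ (translation d)).
by rewrite permKV translationE add0r.
Qed.

(** * The regular alternating subgroup *)

Lemma card_complement01 : #|~: [set 0; 1 : F]| = (q ^ 2 - 2)%N.
Proof. by rewrite cardsCs setCK cardF cards2 eq_sym oner_neq0. Qed.

Definition label (i : 'I_(q ^ 2 - 2)) : F :=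
  enum_val (cast_ord (esym card_complement01) i).

Lemma label_inj : injective label.
Proof. by move=> i j /enum_val_inj/cast_ord_inj. Qed.

Lemma codom_label v : (v \in codom label) = (v != 0) && (v != 1).
Proof.
transitivity (v \in ~: [set 0; 1]); last by rewrite !inE negb_or.
apply/codomP/idP => [[i ->]|v01]; first exact: enum_valP.
exists (cast_ord card_complement01 (enum_rank_in v01 v)).
by rewrite /label cast_ordK enum_rankK_in.
Qed.

Definition alt_embed (h : [subg 'Alt_('I_(q ^ 2 - 2))]) : {perm F} :=
  extend_perm label_inj (sgval h).

Lemma alt_embedM : {morph alt_embed : x y / (x * y)%g}.
Proof. by move=> x y; rewrite /alt_embed -extend_permM. Qed.

(** Only 1 and tau fix 0 and 1 in K, and tau is odd. *)
Lemma alt_embed_meet h : alt_embed h \in K -> h = 1%g.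
Proof.
have fix01 v : v = 0 \/ v = 1 -> alt_embed h v = v.
  move=> v01; apply: extend_perm_out; rewrite codom_label.
  by case: v01 => ->; rewrite eqxx ?andbF.
move=> Kh; have [||h1|ht] := affine_ext_fix01 Kh.
- by apply: fix01; left.
- by apply: fix01; right.
- apply/val_inj/(@extend_perm_inj _ _ _ label_inj).
  by rewrite [LHS]h1 extend_perm1.
have := subgP h; rewrite Alt_even -(odd_extend_perm label_inj).
by rewrite -[extend_perm _ _]/(alt_embed h) ht frobenius_odd.
Qed.

(** Writing Sym(F) as K times the even permutations fixing 0 and 1 asks for k
    in K that agrees with x^-1 at 0 and 1 and has the parity of x. *)
Lemma alt_embed_complement x : exists h, (alt_embed h * x^-1)%g \in K.
Proof.
have x01 : x^-1%g 0 != x^-1%g 1.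
  by rewrite (inj_eq perm_inj) eq_sym oner_neq0.
have [k Kk [kx k0 k1]] :=
  affine_ext_2transitive_parity (odd_perm x) x01.
have [v|s sE] := @extend_perm_onto _ _ _ label_inj (k * x)%g.
  rewrite codom_label permM -negb_or negbK.
  by case/orP => /eqP->; rewrite (k0, k1) permKV.
have Alt_s : s \in ('Alt_('I_(q ^ 2 - 2)))%g.
  by rewrite Alt_even -(odd_extend_perm label_inj) sE odd_permM kx addbb.
by exists (subg _ s); rewrite /alt_embed subgK // sE mulgK.
Qed.

End AffineExt.

Theorem theorem1p4 (q : nat) (F : finFieldType) (tau g : {perm F})
  (q_prime_power : exists p k : nat,
     [/\ prime p, (0 < k)%N & q = (p ^ k)%N])
  (q_mod4 : (q = 3 %[mod 4])%N)
  (card_F : #|F| = (q ^ 2)%N)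
  (tau_frob : forall v : F, tau v = v ^+ q)
  (g_zero : g 0 = 0)
  (g_inv : forall v : F, v != 0 -> g v = v^-1) :
  let Gamma := coset_graph (G := 'Sym_F) (K := affine_ext tau) g in
  [/\ graph_connected Gamma,
      two_arc_transitive Gamma (coset_perms 'Sym_F (affine_ext tau) 'Alt_F),
      is_cayley_graph_on Gamma [subg 'Alt_('I_(q ^ 2 - 2))]
    & graph_regular Gamma (q ^ 2)].
Proof.
move=> Gamma.
have full (x : {perm F}) : x \in ('Sym_F)%G by rewrite inE.
have gV := inversionV g_zero g_inv.
have Dt c := translation_dcoset tau g c.
have Dinj := translation_dcoset_inj
  q_prime_power q_mod4 card_F tau_frob g_zero g_inv.
have Dall := dcoset_translation
  q_prime_power q_mod4 card_F tau_frob g_zero g_inv.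
have K2tr := affine_ext_2transitive_parity q_mod4 card_F tau_frob.
have Kact := translation_stab
  q_prime_power q_mod4 card_F tau_frob g_zero g_inv.
split.
- by apply: (coset_graph_connected full); exact: affine_ext_generates.
- apply: (coset_graph_two_arc_transitive full gV (Dt 0) (Dt 1))
    => [|x|y z Dy Dz yz].
  + by apply/negP => /Dinj/eqP; rewrite eq_sym oner_eq0.
  + have [|k Kk [kx _ _]] := K2tr 0 1 (odd_perm x).
      by rewrite eq_sym oner_neq0.
    by exists k => //; rewrite Alt_even odd_permM kx addbb.
  have [c Kc] := Dall y Dy; have [d Kd] := Dall z Dz.
  have cd : c != d.
    apply: contraNneq yz => dc; rewrite dc in Kc.
    by have := groupM (groupVr Kc) Kd; rewrite !invMg invgK !mulgA !mulgKV.
  have [k Kk [k_even k0 k1]] := K2tr c d false cd.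
  exists k; first by rewrite inE Kk Alt_even k_even.
  split.
    by have := groupM (Kact _ _ _ Kk k0) Kc; rewrite invMg !mulgA !mulgKV.
  by have := groupM (Kact _ _ _ Kk k1) Kd; rewrite invMg !mulgA !mulgKV.
- apply: (coset_graph_cayley full gV (phi := alt_embed card_F)).
  + exact: (inversion_notin q_prime_power (q_gt2 q_mod4) card_F tau_frob).
  + exact: alt_embedM.
  + exact: alt_embed_meet.
  + exact: alt_embed_complement.
rewrite -card_F; apply: (coset_graph_regular full Dt Dall Dinj).
Qed.
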